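(* Let $K:\mathcal X\to\mathcal Y$ be a compact linear operator, let $\{\alpha_n\}_{n\in\mathbb N},\{\gamma_n\}_{n\in\mathbb N}$ be sequences of real numbers with $\alpha_n>0$ and $\gamma_n\ge1/2$ for every $n$, let $y$ be attainable and $x^\dagger=K^\dagger y$. Let $\{x_{\alpha_n,\gamma_n}^n\}_{n\in\mathbb N}$ be a convergent sequence of the nonstationary iterated fractional Tikhonov (NSIFT) method (converging to $x^\dagger$), with $x^\dagger\in\mathcal X_\nu$ for some $\nu>0$, and let $\{\vartheta_n\}_{n\in\mathbb N}$ be a divergent sequence of positive real numbers. If $$\lim_{n\to\infty}\vartheta_n\sigma^\nu\prod_{k=1}^n\Big(1-\frac{\sigma^{2\gamma_k}}{(\sigma^2+\alpha_k)^{\gamma_k}}\Big)=0\qquad\text{for every }\sigma\in\sigma(K)\setminus\{0\}$$ and $$\sup_{\sigma\in\sigma(K)\setminus\{0\}}\vartheta_n\sigma^\nu\prod_{k=1}^n\Big(1-\frac{\sigma^{2\gamma_k}}{(\sigma^2+\alpha_k)^{\gamma_k}}\Big)\le c<\infty\qquad\text{uniformly with respect to }n,$$ then $$\|x^\dagger-x_{\alpha_n,\gamma_n}^n\|=o(\vartheta_n^{-1}).$$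
   Context: $\mathcal X,\mathcal Y$ are Hilbert spaces; $y$ attainable means $y\in R(K)$; $K^\dagger$ is the Moore-Penrose generalized inverse. $(\sigma_m;v_m,u_m)$ is the singular value expansion of $K$ ($Kv_m=\sigma_mu_m$, $K^*u_m=\sigma_mv_m$, $\sigma_m>0$ decreasing); $\sigma(K)$ denotes the closure of $\{\sigma_m\}$. $\mathcal X_\nu=\{x\in\mathcal X:\ x=(K^*K)^{\nu/2}\omega\text{ for some }\omega\in\mathcal X\}$. NSIFT: $x_{\alpha_0,\gamma_0}^0=0$ and, for $n\ge1$, $$(K^*K+\alpha_nI)^{\gamma_n}x_{\alpha_n,\gamma_n}^n=(K^*K)^{\gamma_n-1}K^*y+\big[(K^*K+\alpha_nI)^{\gamma_n}-(K^*K)^{\gamma_n}\big]x_{\alpha_{n-1},\gamma_{n-1}}^{n-1},$$ where $(K^*K)^{\gamma-1}K^*y:=\sum_m\sigma_m^{2\gamma-1}\langle y,u_m\rangle v_m$. *)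

(* Defs.v *)
From HB Require Import structures.
From mathcomp Require Import all_boot all_order all_algebra.
From mathcomp Require Import sesquilinear.
From mathcomp Require Import complex.
From mathcomp Require Import all_classical all_reals all_analysis.
Set Implicit Arguments.
Unset Strict Implicit.
Unset Printing Implicit Defensive.
Import Order.TTheory GRing.Theory Num.Theory numFieldNormedType.Exports.
Local Open Scope classical_set_scope.
Local Open Scope ring_scope.

(* Hilbert spaces are over the real or over the complex numbers; both cases are
   treated at once, R being the type of real numbers in either case. *)
Variant scalar_kind := RealScalars | ComplexScalars.

Definition scalars (R : realType) (s : scalar_kind) : numFieldType :=
  match s with
  | RealScalars => R
  | ComplexScalars => R[i]
  end.

Definition of_real (R : realType) (s : scalar_kind) : R -> scalars R s :=
  match s with
  | RealScalars => fun r => r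
  | ComplexScalars => fun r => real_complex R r
  end.

Definition sconj (R : realType) (s : scalar_kind) : scalars R s -> scalars R s :=
  match s with
  | RealScalars => fun z => z
  | ComplexScalars => fun z => conjc z
  end.

Arguments of_real {R} s r.
Arguments sconj {R s} z.

(* The inner product is linear in its first argument and conjugate-linear in
   its second one. *)
HB.mixin Record CompleteNormedModule_isHilbert (R : realType) (s : scalar_kind)
    X of CompleteNormedModule (scalars R s) X := {
  inner : {dot X for @sconj R s};
  inner_norm : forall x : X, inner x x = `|x| ^+ 2
}.

#[short(type="hilbertType")]
HB.structure Definition Hilbert (R : realType) (s : scalar_kind) :=
  {X of CompleteNormedModule_isHilbert R s X &
        CompleteNormedModule (scalars R s) X}.

Notation "''[' x , y ]" := (inner x y) : ring_scope.

Section Operators.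
Context {R : realType} {s : scalar_kind} {X Y : hilbertType R s}.
Implicit Types (K : {linear X -> Y}).

Definition compact_operator K : Prop :=
  forall B : set X, bounded_set B -> precompact (K @` B).

(* The set below is a singleton for bounded K, by the Riesz representation
   theorem. *)
Definition adjoint K (y : Y) : X :=
  xget 0 [set z | forall x, '[K x, y] = '[x, z]].

(* The graph of the linear extension to R(K) + R(K)^_|_, vanishing on R(K)^_|_,
   of the inverse of K : N(K)^_|_ -> R(K).  On the domain R(K) + R(K)^_|_ the
   set below is a singleton; elsewhere it is empty and the value is the
   irrelevant default 0. *)
Definition moore_penrose K (y : Y) : X :=
  xget 0 [set x | (forall z, K z = 0 -> '[x, z] = 0) /\
                  (forall z, '[y - K x, K z] = 0)].

(* The index set is all of nat when K has infinite rank and {0, ..., r - 1}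
   when K has finite rank r, hence an initial segment of nat; singular values
   are repeated according to multiplicity.  The last field
   says that the two orthonormal systems are complete in N(K)^_|_ and in the
   closure of R(K). *)
Record sve K := Sve {
  sve_idx : set nat;
  sve_val : nat -> R;
  sve_v : nat -> X;
  sve_u : nat -> Y;
  sve_idx_initial : forall i j, (i <= j)%N -> sve_idx j -> sve_idx i;
  sve_val_gt0 : forall i, sve_idx i -> 0 < sve_val i;
  sve_val_decreasing : forall i j, (i <= j)%N -> sve_idx j ->
    sve_val j <= sve_val i;
  sve_v_orthonormal : forall i j, sve_idx i -> sve_idx j ->
    '[sve_v i, sve_v j] = (i == j)%:R;
  sve_u_orthonormal : forall i j, sve_idx i -> sve_idx j ->
    '[sve_u i, sve_u j] = (i == j)%:R;
  sve_vu : forall i, sve_idx i ->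
    K (sve_v i) = of_real s (sve_val i) *: sve_u i;
  sve_uv : forall i, sve_idx i ->
    adjoint K (sve_u i) = of_real s (sve_val i) *: sve_v i;
  sve_expansion : forall x,
    \sum_(0 <= i < n | i \in sve_idx)
       (of_real s (sve_val i) * '[x, sve_v i]) *: sve_u i
    @[n --> \oo] --> K x
}.

Context {K : {linear X -> Y}}.
Implicit Types (S : sve K).

Definition sve_spectrum S : set R := closure [set sve_val S i | i in sve_idx S].

Definition v_sum S (c : nat -> scalars R s) : X :=
  \big[+%R/0]_(0 <= i <oo | i \in sve_idx S) (c i *: sve_v S i).

(* f(K^*K).  The spectral decomposition of K^*K has the eigenvalues sigma_i^2
   with eigenvectors v_i, together with the eigenvalue 0 on N(K), onto which
   x - \sum_i <x, v_i> v_i is the orthogonal projection of x. *)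
Definition fun_KstK S (f : R -> R) (x : X) : X :=
  v_sum S (fun i => of_real s (f (sve_val S i ^+ 2)) * '[x, sve_v S i]) +
  of_real s (f 0) *: (x - v_sum S (fun i => '[x, sve_v S i])).

(* (K^*K + a I)^g *)
Definition pow_KstK_shift S (a g : R) : X -> X :=
  fun_KstK S (fun t => (t + a) `^ g).

(* (K^*K)^g.  For g > 0 it vanishes on N(K), as 0 `^ g = 0. *)
Definition pow_KstK S (g : R) : X -> X := fun_KstK S (fun t => t `^ g).

(* (K^*K)^(g - 1) K^* *)
Definition pow_KstK_adj S (g : R) (y : Y) : X :=
  v_sum S (fun i =>
    of_real s (sve_val S i `^ (2 * g - 1)) * '[y, sve_u S i]).

Definition source_space S (nu : R) : set X := range (pow_KstK S (nu / 2)).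

Definition is_NSIFT S (alpha gamma : nat -> R) (y : Y) (x : nat -> X) : Prop :=
  x 0%N = 0 /\
  forall n, (1 <= n)%N ->
    pow_KstK_shift S (alpha n) (gamma n) (x n) =
      pow_KstK_adj S (gamma n) y +
      (pow_KstK_shift S (alpha n) (gamma n) (x n.-1) -
       pow_KstK S (gamma n) (x n.-1)).

End Operators.

Definition NSIFT_residual {R : realType} (alpha gamma : nat -> R) (n : nat)
    (sigma : R) : R :=
  \prod_(1 <= k < n.+1)
    (1 - sigma `^ (2 * gamma k) / (sigma ^+ 2 + alpha k) `^ gamma k).

(* Main.v *)
Require Import Defs.
From HB Require Import structures.
From mathcomp Require Import all_boot all_order all_algebra.
From mathcomp Require Import sesquilinear.
From mathcomp Require Import complex ring.
From mathcomp Require Import all_classical all_reals all_analysis.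
Import Order.TTheory GRing.Theory Num.Theory numFieldNormedType.Exports.
Local Open Scope classical_set_scope.
Local Open Scope ring_scope.

(** The NSIFT recursion is diagonal in the singular basis.  Testing it against
    v_i and using <y, u_i> = sigma_i <x^+, v_i>, the error e_n = x^+ - x_n
    satisfies
      <e_n, v_i> = (1 - sigma_i^(2 gamma_n) / (sigma_i^2 + alpha_n)^gamma_n)
                   <e_(n-1), v_i>,
    so that <e_n, v_i> = r_n(sigma_i) <x^+, v_i>, where r_n is the product of
    the first n filters ([NSIFT_error_coef]).  The source condition
    x^+ = (K^*K)^(nu/2) omega turns this into
      theta_n <e_n, v_i> =
        (theta_n sigma_i^nu r_n(sigma_i)) <omega, v_i>.
    The factors in parentheses are bounded by c and, for each fixed i, tend to
    0, while the coefficients <omega, v_i> are square summable by Bessel's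
    inequality.  Dominated convergence for the series of squares
    ([cvg_weighted0]) gives theta_n e_n --> 0, which is the claim.

    The basis v spans only the orthogonal complement of N(K), so one also has
    to know that e_n has no component in N(K).  On N(K) the operator
    (K^*K + alpha_n)^gamma_n is multiplication by alpha_n^gamma_n <> 0 and the
    other operators of the recursion vanish, hence the component of x_n there
    is that of x_0 = 0 ([null_part_NSIFT]); and x^+ has none because it is in
    the range of a positive power of K^*K. *)

(** * The embedding of the reals into the scalars *)

Section Scalars.
Context {R : realType} {s : scalar_kind}.
Implicit Types (r t : R) (z : scalars R s).

Lemma of_realD r t : of_real s (r + t) = of_real s r + of_real s t.
Proof. by case: s => //=; rewrite -rmorphD. Qed.

Lemma of_realM r t : of_real s (r * t) = of_real s r * of_real s t.
Proof. by case: s => //=; rewrite -rmorphM. Qed.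

Lemma of_real0 : of_real s (0 : R) = 0.
Proof. by case: s. Qed.

Lemma of_real1 : of_real s (1 : R) = 1.
Proof. by case: s. Qed.

Lemma of_realB r t : of_real s (r - t) = of_real s r - of_real s t.
Proof. by case: s => //=; rewrite -rmorphB. Qed.

Lemma ler_of_real r t : (of_real s r <= of_real s t) = (r <= t).
Proof. by case: s => //=; exact: lecR. Qed.

Lemma ltr_of_real r t : (of_real s r < of_real s t) = (r < t).
Proof. by case: s => //=; exact: ltcR. Qed.

Lemma norm_of_real r : `|of_real s r| = of_real s `|r|.
Proof.
case: s => //=.
by rewrite normc_def /= expr0n /= addr0 sqrtr_sqr.
Qed.

Lemma of_real_inj : injective (of_real s : R -> _).
Proof. by move=> r t rt; apply/le_anti; rewrite -!ler_of_real rt lexx. Qed.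

Lemma of_real_neq0 r : r != 0 -> of_real s r != 0.
Proof. by rewrite -of_real0; apply: contra_neq; exact: of_real_inj. Qed.

(** Norms in a complex space are complex numbers; this is what allows the
    completeness of the real line to be used on them. *)
Lemma ge0_of_real z : 0 <= z -> exists r, z = of_real s r.
Proof.
case: s z => /= z z0; first by exists z.
by exists (complex.Re z); rewrite RRe_real// ger0_real.
Qed.

Lemma of_realV r : of_real s r^-1 = (of_real s r)^-1.
Proof.
have [->|r0] := eqVneq r 0; first by rewrite invr0 of_real0 invr0.
have := of_real_neq0 _ r0 => r0'.
by apply: (mulfI r0'); rewrite -of_realM !divff// of_real1.
Qed.

Lemma of_real_sum I (l : seq I) (P : pred I) (f : I -> R) :
  of_real s (\sum_(i <- l | P i) f i) = \sum_(i <- l | P i) of_real s (f i).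
Proof. exact: (big_morph _ of_realD of_real0). Qed.

Lemma cvg_of_real (f : nat -> R) r : f n @[n --> \oo] --> r ->
  of_real s (f n) @[n --> \oo] --> of_real s r.
Proof.
move=> /cvgrPdist_lt fr; apply/cvgrPdist_lt => e e0.
have [e' ee'] := ge0_of_real _ (ltW e0).
have e'0 : 0 < e' by rewrite -ltr_of_real of_real0 -ee'.
have := fr _ e'0; apply: filterS => n.
by rewrite -of_realB norm_of_real ee' ltr_of_real.
Qed.

Lemma sconj0 : sconj (0 : scalars R s) = 0.
Proof. by case: s => //=; exact: conjc0. Qed.

End Scalars.

(** * Series along an orthonormal system *)

Lemma cvg_sum_seq (F : numFieldType) (I : Type) (r : seq I) (P : pred I)
  (f : I -> nat -> F) (l : I -> F) :
  (forall i, P i -> f i n @[n --> \oo] --> l i) ->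
  \sum_(i <- r | P i) f i n @[n --> \oo] --> \sum_(i <- r | P i) l i.
Proof. exact: (@cvg_big _ _ +%R 0 P (@add_continuous F)). Qed.

Section Orthonormal.
Context {R : realType} {s : scalar_kind} {X : hilbertType R s}.
Local Notation F := (scalars R s).
Implicit Types (x y : X) (a b : nat -> F).

Lemma innerC x y : '[x, y] = sconj '[y, x].
Proof. by move: inner => [? [[?] [? ? ? ?] [H]]] /=; rewrite H expr0 mul1r. Qed.

Lemma normD_orthogonal x y : '[x, y] = 0 ->
  `|x + y| ^+ 2 = `|x| ^+ 2 + `|y| ^+ 2.
Proof.
move=> xy; rewrite -!inner_norm linearDl !linearDr/= xy (innerC y x) xy sconj0.
by rewrite addr0 add0r.
Qed.

(** Cauchy-Schwarz: subtracting from x its projection a v onto v leaves a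
    vector orthogonal to a v, so Pythagoras gives |a v| <= |x|. *)
Lemma norm_inner_le x v : `|'[x, v]| <= `|x| * `|v|.
Proof.
have [->|v0] := eqVneq v 0; first by rewrite linear0r !normr0 mulr0.
have nv : 0 < `|v| by rewrite normr_gt0.
set a := '[x, v] / '[v, v].
have o : '[x - a *: v, a *: v] = 0.
  rewrite linearZr_LR/= linearBl/= linearZl_LR/= divfK ?subrr ?mulr0//.
  by rewrite inner_norm expf_neq0// gt_eqF.
have := normD_orthogonal _ _ o; rewrite subrK => xE.
have ax : `|a *: v| <= `|x|.
  rewrite -(@ler_pXn2r _ 2) ?nnegrE// xE lerDr.
  by rewrite exprn_ge0.
rewrite -ler_pdivrMr// (le_trans _ ax)// normrZ normrM normfV inner_norm normrX.
by rewrite normr_id expr2 invfM mulrA divfK ?gt_eqF.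
Qed.

Lemma cvg_inner (f : nat -> X) x v :
  f n @[n --> \oo] --> x -> '[f n, v] @[n --> \oo] --> '[x, v].
Proof.
move=> /cvgrPdist_lt fx; apply/cvgrPdist_lt => e e0.
have v1 : 0 < `|v| + 1 by rewrite ltr_wpDl.
apply: filterS (fx _ (divr_gt0 e0 v1)) => n.
rewrite ltr_pdivlMr//; apply: le_lt_trans.
rewrite -linearBl/= (le_trans (norm_inner_le _ _))//.
by rewrite ler_wpM2l// lerDl.
Qed.

(** The indices are restricted to I because a finite-rank operator has only
    finitely many singular values; a lower bound m is kept so that tails are
    sums of the same kind. *)
Definition partial_sum (I : set nat) (v : nat -> X) a (m n : nat) : X :=
  \sum_(m <= i < n | i \in I) a i *: v i.

Context {I : set nat} {v : nat -> X}.
Hypothesis v_orthonormal : forall i j, I i -> I j -> '[v i, v j] = (i == j)%:R.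

Lemma inner_partial_sum a m n j : I j ->
  '[partial_sum I v a m n, v j] = if (m <= j < n)%N then a j else 0.
Proof.
move=> Ij; rewrite /partial_sum linear_sumlz/=.
have -> : \sum_(m <= i < n | i \in I) '[a i *: v i, v j] =
    \sum_(m <= i < n | i == j) a i.
  rewrite big_mkcond [RHS]big_mkcond/=; apply: eq_bigr => i _.
  case: ifPn => [/set_mem Ii|/negP iI]; last first.
    by case: eqP => // ij; case: iI; rewrite ij; exact: mem_set.
  rewrite linearZl_LR/= v_orthonormal//.
  by case: eqP => _; rewrite ?mulr1 ?mulr0.
case: ifPn => mjn; last first.
  rewrite big_nat_cond big1// => i /andP[imn /eqP ij].
  by rewrite -ij imn in mjn.
rewrite -big_filter -[RHS](big_seq1 (+%R) j a).
rewrite -(filter_pred1_uniq (s := index_iota m n)).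
- by apply: eq_bigl.
- exact: iota_uniq.
- by rewrite mem_index_iota.
Qed.

Lemma norm_partial_sum a m n :
  `|partial_sum I v a m n| ^+ 2 = \sum_(m <= i < n | i \in I) `|a i| ^+ 2.
Proof.
have [mn|nm] := leqP m n; last first.
  by rewrite /partial_sum !big_geq ?normr0 ?expr0n// ltnW.
elim: n mn => [|n IH] mn.
  by rewrite /partial_sum !big_geq ?normr0 ?expr0n.
rewrite leq_eqVlt ltnS in mn; case/orP: mn => [/eqP ->|mn].
  by rewrite /partial_sum !big_geq ?normr0 ?expr0n.
have last1 (V : nmodType) (f : nat -> V) :
    \sum_(n <= i < n.+1 | i \in I) f i = if n \in I then f n else 0.
  by rewrite big_mkcond big_nat1.
rewrite (@big_cat_nat _ _ _ n)//= -IH// last1.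
rewrite {1}/partial_sum (@big_cat_nat _ _ _ n)//= last1.
rewrite -/(partial_sum I v a m n).
case: ifPn => [/set_mem In|_]; last by rewrite !addr0.
rewrite normD_orthogonal; last first.
  by rewrite linearZr_LR/= inner_partial_sum// ltnn andbF mulr0.
rewrite normrZ exprMn -(inner_norm (v n)) v_orthonormal// eqxx mulr1//.
Qed.

Lemma eq_partial_sum a b m n : (forall i, I i -> a i = b i) ->
  partial_sum I v a m n = partial_sum I v b m n.
Proof. by move=> ab; apply: eq_bigr => i /set_mem Ii; rewrite ab. Qed.

(** The j-th coefficient of the partial sums is constant past j, and the inner
    product is continuous, so it survives in the limit. *)
Lemma inner_cvg_partial_sum a x j : I j ->
  partial_sum I v a 0 n @[n --> \oo] --> x -> '[x, v j] = a j.
Proof.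
move=> Ij /cvg_inner - /(_ (v j)) h.
apply: (cvg_unique (@norm_hausdorff _ F^o) h).
apply: cvg_near_cst; exists j.+1 => // n /= jn.
by rewrite inner_partial_sum// jn.
Qed.

Lemma bessel x n : \sum_(0 <= i < n | i \in I) `|'[x, v i]| ^+ 2 <= `|x| ^+ 2.
Proof.
rewrite -norm_partial_sum; set p := partial_sum _ _ _ _ _.
have o : '[x - p, p] = 0.
  rewrite linearBl/= {3}/p.
  rewrite /partial_sum !linear_sumr/= -sumrB big1_seq// => i /andP[/set_mem Ii].
  rewrite mem_index_iota/= => i_n.
  by rewrite !linearZr_LR/= inner_partial_sum//= i_n subrr.
have := normD_orthogonal _ _ o; rewrite subrK => ->.
by rewrite lerDr exprn_ge0.
Qed.

Definition square_summable a : Prop := exists M : F, forall n,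
  \sum_(0 <= i < n | i \in I) `|a i| ^+ 2 <= M.

Lemma square_summable_weighted (C : F) (f : nat -> F) x : 0 <= C ->
  (forall i, I i -> `|f i| <= C) -> square_summable (fun i => f i * '[x, v i]).
Proof.
move=> C0 fC; exists (C ^+ 2 * `|x| ^+ 2) => n.
apply: (le_trans _ (ler_wpM2l _ (bessel x n))); last by rewrite exprn_ge0.
rewrite mulr_sumr ler_sum// => i /set_mem Ii.
by rewrite normrM exprMn ler_wpM2r ?exprn_ge0// lerXn2r ?nnegrE// fC.
Qed.

Lemma square_summable_coef x : square_summable (fun i => '[x, v i]).
Proof. by exists (`|x| ^+ 2); exact: bessel. Qed.

(** The squares are nonnegative scalars, hence images of reals, whose partial
    sums form a bounded nondecreasing sequence of R. *)
Lemma square_summable_tail a : square_summable a ->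
  forall e : F, 0 < e -> exists N, forall n, (N <= n)%N ->
    \sum_(N <= i < n | i \in I) `|a i| ^+ 2 < e.
Proof.
move=> [M aM] e e0.
have [e' ee'] := ge0_of_real _ (ltW e0).
have e'0 : 0 < e' by rewrite -(@ltr_of_real _ s) of_real0 -ee'.
have M0 : 0 <= M by have := aM 0; rewrite big_geq.
have [M' MM'] := ge0_of_real _ M0.
have /choice[b ab] : forall i, exists r, `|a i| ^+ 2 = of_real s r.
  by move=> i; apply: ge0_of_real; rewrite exprn_ge0.
have b0 i : 0 <= b i by rewrite -(@ler_of_real _ s) of_real0 -ab exprn_ge0.
have E m n : \sum_(m <= i < n | i \in I) `|a i| ^+ 2 =
    of_real s (\sum_(m <= i < n | i \in I) b i).
  by rewrite of_real_sum; apply: eq_bigr.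
pose u n := \sum_(0 <= i < n | i \in I) b i.
have u_nd : {homo u : n m / (n <= m)%N >-> n <= m}.
  by move=> n m nm; rewrite /u (@big_cat_nat _ _ _ n 0 m)//= lerDl sumr_ge0.
have u_cvg : cvgn u.
  apply: nondecreasing_is_cvgn => //; exists M' => _ [n _ <-].
  by rewrite -(@ler_of_real _ s) -E -MM'.
have /cvgrPdist_lt/(_ _ e'0)[N _ /(_ N (leqnn N)) uN] := u_cvg.
exists N => n Nn; rewrite E ee' ltr_of_real.
have un := nondecreasing_cvgn_le u_nd u_cvg n.
have -> : \sum_(N <= i < n | i \in I) b i = u n - u N.
  by rewrite /u (@big_cat_nat _ _ _ N 0 n)//= addrAC subrr add0r.
by apply: le_lt_trans uN; rewrite (le_trans _ (ler_norm _))// lerB.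
Qed.

(** Riesz-Fischer: by Pythagoras the Cauchy criterion for the vectors is the
    smallness of the tails of the scalar series of squares. *)
Lemma is_cvg_partial_sum a : square_summable a -> cvgn (partial_sum I v a 0).
Proof.
move=> aM; apply/cauchy_cvgP/cauchy_exP => e e0.
have [N NP] := square_summable_tail _ aM (e ^+ 2) (exprn_gt0 _ e0).
exists (partial_sum I v a 0 N); exists N => // n /= Nn.
rewrite -ball_normE/= -(@ltr_pXn2r _ 2) ?nnegrE// ?ltW//.
rewrite /partial_sum (@big_cat_nat _ _ _ N 0 n)//=.
rewrite opprD addrA subrr add0r normrN.
by rewrite -/(partial_sum I v a N n) norm_partial_sum NP.
Qed.

(** Dominated convergence for orthogonal series.  Beyond a suitable N the tail
    is small uniformly in n because the weights are bounded by C; the finitely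
    many terms before N tend to 0 separately. *)
Lemma cvg_weighted0 (w : nat -> X) (g : nat -> nat -> F) a (C : F) :
  square_summable a -> 0 <= C ->
  (forall n i, I i -> `|g n i| <= C) ->
  (forall i, I i -> g n i @[n --> \oo] --> 0) ->
  (forall n, partial_sum I v (fun i => g n i * a i) 0 m @[m --> \oo] --> w n) ->
  w n @[n --> \oo] --> 0.
Proof.
move=> aM C0 gC g0 gw.
apply/cvgr0Pnorm_lt => e e0.
have d0 : 0 < e / 2 by rewrite divr_gt0.
set d := e / 2 in d0.
have d20 : 0 < d ^+ 2 / 2 by rewrite divr_gt0// exprn_gt0.
(* C itself may be 0, and the tail is divided by the square of the bound. *)
have C1 : 0 < (C + 1) ^+ 2 by rewrite exprn_gt0// ltr_wpDl.
have [N NP] := square_summable_tail _ aM _ (divr_gt0 d20 C1).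
have head : \sum_(0 <= i < N | i \in I) `|g n i * a i| ^+ 2
    @[n --> \oo] --> (0 : F).
  have := cvg_sum_seq F nat (index_iota 0 N) (fun i => i \in I)
    (fun i n => `|g n i * a i| ^+ 2) (fun=> 0).
  rewrite big1//; apply => i /set_mem Ii.
  have : g n i * a i @[n --> \oo] --> 0 * a i.
    by apply: cvgM; [exact: g0|exact: cvg_cst].
  rewrite mul0r => h.
  have h' : `|g n i * a i| @[n --> \oo] --> (0 : F).
    have := @cvg_norm _ F^o _ _ _ _ _ h; rewrite normr0; apply.
  have := cvgM h' h'; rewrite mulr0; apply.
move/cvgr0Pnorm_lt: head => /(_ _ d20); apply: filterS => n.
rewrite ger0_norm; last by rewrite sumr_ge0// => i _; rewrite exprn_ge0.
move=> hd.
have bd m : (N <= m)%N -> `|partial_sum I v (fun i => g n i * a i) 0 m| < d.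
  move=> Nm; rewrite -(@ltr_pXn2r _ 2) ?nnegrE// ?ltW// norm_partial_sum.
  rewrite (@big_cat_nat _ _ _ N)//= [ltRHS](splitr (d ^+ 2)) ltrD//.
  apply: (@le_lt_trans _ _
      (\sum_(N <= i < m | i \in I) (C + 1) ^+ 2 * `|a i| ^+ 2)).
    apply: ler_sum => i /set_mem Ii; rewrite normrM exprMn.
    rewrite ler_wpM2r ?exprn_ge0// lerXn2r ?nnegrE//.
      by rewrite addr_ge0.
    by rewrite (le_trans (gC n i Ii))// lerDl.
  by rewrite -mulr_sumr mulrC -ltr_pdivlMr// NP.
have /cvgrPdist_lt/(_ _ d0)[m0 _ m0P] := gw n.
have := m0P (maxn N m0) (leq_maxr _ _) => wm.
have := bd (maxn N m0) (leq_maxl _ _) => bm.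
rewrite -(subrK (partial_sum I v (fun i => g n i * a i) 0 (maxn N m0)) (w n)).
by rewrite (le_lt_trans (ler_normD _ _))// (splitr e) ltrD.
Qed.

End Orthonormal.

(** * Functional calculus of K^*K in the singular basis *)

Section SpectralCalculus.
Context {R : realType} {s : scalar_kind} {X Y : hilbertType R s}.
Context {K : {linear X -> Y}} (S : sve K).
Local Notation F := (scalars R s).
Local Notation I := (sve_idx S).
Local Notation v := (sve_v S).
Local Notation u := (sve_u S).
Local Notation sg := (sve_val S).
Implicit Types (x z : X) (y : Y) (a b : nat -> F) (f : R -> R).

Let v_orthonormal := @sve_v_orthonormal _ _ _ _ _ S.
Let u_orthonormal := @sve_u_orthonormal _ _ _ _ _ S.

Lemma eq_v_sum a b : (forall i, I i -> a i = b i) -> v_sum S a = v_sum S b.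
Proof.
move=> ab; have E : partial_sum I v a 0 = partial_sum I v b 0.
  by apply/funext => n; exact: eq_partial_sum.
by rewrite /v_sum -/(partial_sum I v a 0) -/(partial_sum I v b 0) E.
Qed.

Lemma v_sum_cvg a : square_summable (I := I) a ->
  partial_sum I v a 0 n @[n --> \oo] --> v_sum S a.
Proof. by move=> aM; exact: (is_cvg_partial_sum v_orthonormal _ aM). Qed.

Lemma inner_v_sum a j : square_summable (I := I) a -> I j ->
  '[v_sum S a, v j] = a j.
Proof.
move=> aM Ij.
exact: (inner_cvg_partial_sum v_orthonormal _ _ _ Ij (v_sum_cvg _ aM)).
Qed.

(** The orthogonal projection onto N(K). *)
Definition null_part x : X := x - v_sum S (fun i => '[x, v i]).

Lemma null_partZD (k : F) x z :
  null_part (k *: x + z) = k *: null_part x + null_part z.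
Proof.
rewrite /null_part scalerBr addrACA -opprD; congr (_ - _).
apply: cvg_lim; first exact: norm_hausdorff.
have hx := v_sum_cvg _ (square_summable_coef v_orthonormal x).
have hz := v_sum_cvg _ (square_summable_coef v_orthonormal z).
have h := @cvgD _ _ _ _ _ _ _ _ _ (@cvgZl_tmp _ _ _ _ _ k _ _ hx) hz.
rewrite -[X in X @ _]/(partial_sum I v (fun i => '[k *: x + z, v i]) 0).
suff <- : (k \*: partial_sum I v (fun i => '[x, v i]) 0) +
    partial_sum I v (fun i => '[z, v i]) 0 =
    partial_sum I v (fun i => '[k *: x + z, v i]) 0 by exact: h.
apply/funext => n; rewrite /partial_sum/= -[LHS]/(k *: _ + _).
rewrite scaler_sumr -big_split/=.
by apply: eq_bigr => i _; rewrite linearPl/= scalerDl scalerA.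
Qed.

Lemma null_partD x z : null_part (x + z) = null_part x + null_part z.
Proof. by have := null_partZD 1 x z; rewrite !scale1r. Qed.

Lemma null_part0 : null_part 0 = 0.
Proof. by have := null_partZD (-1) 0 0; rewrite scaler0 addr0 scaleN1r addNr. Qed.

Lemma null_partZ (k : F) x : null_part (k *: x) = k *: null_part x.
Proof. by have := null_partZD k x 0; rewrite null_part0 !addr0. Qed.

Lemma null_partB x z : null_part (x - z) = null_part x - null_part z.
Proof. by rewrite -scaleN1r null_partD null_partZ scaleN1r. Qed.

Lemma null_part_v_sum a : square_summable (I := I) a ->
  null_part (v_sum S a) = 0.
Proof.
move=> aM; rewrite /null_part (eq_v_sum _ a) ?subrr// => i Ii.
exact: inner_v_sum.
Qed.

Lemma inner_null_part x j : I j -> '[null_part x, v j] = 0.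
Proof.
move=> Ij; rewrite linearBl/= inner_v_sum ?subrr//.
exact: (square_summable_coef v_orthonormal x).
Qed.

Definition bounded_on_spectrum f := exists C, forall i, I i ->
  `|f (sg i ^+ 2)| <= C.

(** The singular values decrease, so f is largest at the square of the first
    one. *)
Lemma bounded_on_spectrum_nd f : (forall t, 0 <= t -> 0 <= f t) ->
  (forall t t', 0 <= t -> t <= t' -> f t <= f t') -> bounded_on_spectrum f.
Proof.
move=> f0 fnd; exists (f (sg 0%N ^+ 2)) => i Ii.
rewrite ger0_norm; last by rewrite f0// sqr_ge0.
rewrite fnd ?sqr_ge0// lerXn2r ?nnegrE//.
- exact: ltW (sve_val_gt0 Ii).
- exact: ltW (sve_val_gt0 (sve_idx_initial (leq0n i) Ii)).
- exact: sve_val_decreasing.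
Qed.

Lemma square_summable_fun f x : bounded_on_spectrum f ->
  square_summable (I := I) (fun i => of_real s (f (sg i ^+ 2)) * '[x, v i]).
Proof.
move=> [C fC]; apply: (square_summable_weighted v_orthonormal (of_real s `|C|)).
  by rewrite -of_real0 ler_of_real.
move=> i Ii; rewrite norm_of_real ler_of_real (le_trans (fC i Ii))//.
exact: ler_norm.
Qed.

(** Boundedness makes the series that defines f(K^*K) x converge; without it the
    limit operator may return an arbitrary point. *)
Lemma inner_fun_KstK f x j : bounded_on_spectrum f -> I j ->
  '[fun_KstK S f x, v j] = of_real s (f (sg j ^+ 2)) * '[x, v j].
Proof.
move=> fb Ij; rewrite linearDl/= linearZl_LR/= inner_null_part// mulr0 addr0.
by rewrite inner_v_sum//; exact: square_summable_fun.
Qed.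

Lemma null_part_fun_KstK f x : bounded_on_spectrum f ->
  null_part (fun_KstK S f x) = of_real s (f 0) *: null_part x.
Proof.
move=> fb; rewrite null_partD null_part_v_sum ?add0r; last first.
  exact: square_summable_fun.
rewrite -/(null_part x) null_partZ; congr (_ *: _).
rewrite [X in null_part X]/null_part null_partB null_part_v_sum ?subr0//.
exact: square_summable_coef.
Qed.

Lemma null_part_eq0_cvg x : null_part x = 0 ->
  partial_sum I v (fun i => '[x, v i]) 0 n @[n --> \oo] --> x.
Proof.
move=> /eqP; rewrite subr_eq0 => /eqP xE; rewrite {2}xE.
exact/v_sum_cvg/square_summable_coef.
Qed.

Lemma inner_K x j : I j -> '[K x, u j] = of_real s (sg j) * '[x, v j].
Proof.
move=> Ij; exact: (inner_cvg_partial_sum u_orthonormal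
  (fun i => of_real s (sg i) * '[x, v i]) _ _ Ij (@sve_expansion _ _ _ _ _ S x)).
Qed.

Lemma K_eq0 x : (forall i, I i -> '[x, v i] = 0) -> K x = 0.
Proof.
move=> x0; apply: (cvg_unique _ (@sve_expansion _ _ _ _ _ S x)).
  exact: norm_hausdorff.
apply: cvg_near_cst; near=> n; rewrite big1// => i /set_mem Ii.
by rewrite x0// mulr0 scale0r.
Unshelve. all: by end_near. Qed.

Lemma coef_ker_eq0 z i : K z = 0 -> I i -> '[z, v i] = 0.
Proof.
move=> Kz Ii; have := inner_K z i Ii; rewrite Kz linear0l => /esym/eqP.
rewrite mulf_eq0 => /orP[/eqP sg0|/eqP//].
have := of_real_neq0 (s := s) _ (lt0r_neq0 (sve_val_gt0 Ii)).
by rewrite sg0 eqxx.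
Qed.

(** Writing y = K x0, the orthogonal projection of x0 onto the complement of
    N(K) has the two properties that define the generalized inverse, so the
    value chosen there has them too; testing the second one against
    x0 - K^+ y yields |y - K K^+ y|^2 = 0. *)
Lemma moore_penroseK y : range K y -> K (moore_penrose K y) = y.
Proof.
move=> [x0 _ <-]; pose p := v_sum S (fun i => '[x0, v i]).
have cp i : I i -> '[p, v i] = '[x0, v i].
  by move=> Ii; rewrite inner_v_sum//; exact: square_summable_coef.
have [] := @xgetPex _ 0 [set x | (forall z, K z = 0 -> '[x, z] = 0) /\
                  (forall z, '[K x0 - K x, K z] = 0)].
  exists p; split => z.
    move=> Kz; have := v_sum_cvg _ (square_summable_coef v_orthonormal x0).
    move=> /cvg_inner - /(_ z) h.
    apply: (cvg_unique (@norm_hausdorff _ F^o) h).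
    apply: cvg_near_cst; near=> n; rewrite /partial_sum linear_sumlz/=.
    rewrite big1// => i /set_mem Ii.
    by rewrite linearZl_LR/= (innerC (v i)) (coef_ker_eq0 z)// sconj0 mulr0.
  rewrite -linearB/= (K_eq0 (x0 - p)) ?linear0l// => i Ii.
  by rewrite linearBl/= cp// subrr.
rewrite -/(moore_penrose K (K x0)) => _ h.
have := h (x0 - moore_penrose K (K x0)); rewrite linearB/= inner_norm.
by move/eqP; rewrite expf_eq0/= normr_eq0 subr_eq0 => /eqP.
Unshelve. all: by end_near. Qed.

End SpectralCalculus.

(** * The NSIFT iteration *)

Lemma powR_sqr {R : realType} (t p : R) : 0 <= t -> (t ^+ 2) `^ p = t `^ (2 * p).
Proof. by move=> t0; rewrite powRrM (powR_mulrn 2 t0). Qed.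

Definition NSIFT_factor {R : realType} (a g sigma : R) : R :=
  1 - sigma `^ (2 * g) / (sigma ^+ 2 + a) `^ g.

Lemma NSIFT_factor_ge0 {R : realType} (a g sigma : R) :
  0 < a -> 0 <= g -> 0 <= sigma -> 0 <= NSIFT_factor a g sigma.
Proof.
move=> a0 g0 s0; have sa : 0 < sigma ^+ 2 + a by rewrite ltr_wpDl ?sqr_ge0.
rewrite subr_ge0 ler_pdivrMr ?powR_gt0// mul1r -powR_sqr//.
by rewrite ge0_ler_powR ?nnegrE ?sqr_ge0 ?(ltW sa)// lerDl ltW.
Qed.

Lemma NSIFT_residualS {R : realType} (alpha gamma : nat -> R) n sigma :
  NSIFT_residual alpha gamma n.+1 sigma =
  NSIFT_residual alpha gamma n sigma *
    NSIFT_factor (alpha n.+1) (gamma n.+1) sigma.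
Proof. by rewrite /NSIFT_residual big_nat_recr. Qed.

Lemma NSIFT_residual_ge0 {R : realType} (alpha gamma : nat -> R) n sigma :
  (forall k, 0 < alpha k) -> (forall k, 0 <= gamma k) -> 0 <= sigma ->
  0 <= NSIFT_residual alpha gamma n sigma.
Proof. by move=> a0 g0 s0; apply: prodr_ge0 => k _; exact: NSIFT_factor_ge0. Qed.

(** One coordinate of one step: here A = (sigma^2 + alpha)^gamma,
    B = sigma^(2 gamma), D is the coefficient of the exact solution, and Z', Z
    are those of two consecutive iterates. *)
Lemma relaxation_error {F : fieldType} (A B D Z Z' : F) : A != 0 ->
  A * Z = B * D + (A * Z' - B * Z') -> D - Z = (D - Z') * (1 - B / A).
Proof.
move=> A0 AZ; apply: (mulfI A0); rewrite mulrBr AZ.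
by field.
Qed.

Section NSIFT.
Context {R : realType} {s : scalar_kind} {X Y : hilbertType R s}.
Context {K : {linear X -> Y}} (S : sve K).
Local Notation I := (sve_idx S).
Local Notation v := (sve_v S).
Local Notation u := (sve_u S).
Local Notation sg := (sve_val S).

Lemma bounded_pow g : 0 <= g -> bounded_on_spectrum S (fun t => t `^ g).
Proof.
move=> g0; apply: bounded_on_spectrum_nd => [t _|t t' t0 tt'].
  exact: powR_ge0.
by rewrite ge0_ler_powR ?nnegrE// (le_trans t0).
Qed.

Lemma bounded_pow_shift a g : 0 <= a -> 0 <= g ->
  bounded_on_spectrum S (fun t => (t + a) `^ g).
Proof.
move=> a0 g0; apply: bounded_on_spectrum_nd => [t _|t t' t0 tt'].
  exact: powR_ge0.
have t'0 := le_trans t0 tt'.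
by rewrite ge0_ler_powR ?nnegrE ?addr_ge0// lerD2r.
Qed.

Context {alpha gamma : nat -> R} {y : Y} {xdag : X} {x : nat -> X}.
Hypothesis alpha_gt0 : forall n, 0 < alpha n.
Hypothesis gamma_gt0 : forall n, 0 < gamma n.
Hypothesis K_xdag : K xdag = y.
Hypothesis x_NSIFT : is_NSIFT S alpha gamma y x.

Let gamma_ge0 n : 0 <= gamma n := ltW (gamma_gt0 n).

(** Replacing the data y by the exact solution also makes the convergence of
    the series for (K^*K)^(gamma-1) K^* y visible: the exponent 2 gamma is
    positive and the coefficients of the solution are square summable. *)
Lemma pow_KstK_adj_coefE n i : I i ->
  of_real s (sg i `^ (2 * gamma n - 1)) * '[y, u i] =
  of_real s ((sg i ^+ 2) `^ gamma n) * '[xdag, v i].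
Proof.
move=> Ii; have s0 := sve_val_gt0 Ii.
rewrite -K_xdag inner_K// mulrA -of_realM powR_sqr ?(ltW s0)//.
congr (of_real s _ * _).
by rewrite -{2}(powRr1 (ltW s0)) -powRD ?subrK// (gt_eqF s0) implybT.
Qed.

Lemma pow_KstK_adjE n : pow_KstK_adj S (gamma n) y =
  v_sum S (fun i => of_real s ((sg i ^+ 2) `^ gamma n) * '[xdag, v i]).
Proof. by apply: eq_v_sum => i; exact: pow_KstK_adj_coefE. Qed.

(** On N(K) the recursion reads alpha^gamma x_n = alpha^gamma x_(n-1), starting
    from 0. *)
Lemma null_part_NSIFT n : null_part S (x n) = 0.
Proof.
have [x0 rec] := x_NSIFT.
elim: n => [|n IH]; first by rewrite x0 null_part0.
have := congr1 (null_part S) (rec n.+1 isT).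
rewrite null_partD null_partB pow_KstK_adjE null_part_v_sum; last first.
  exact/(square_summable_fun S (fun t => t `^ gamma n.+1))/bounded_pow.
rewrite !null_part_fun_KstK;
  [|exact: bounded_pow|exact/bounded_pow_shift/gamma_ge0/ltW..].
rewrite IH !scaler0 subrr addr0 add0r => /eqP.
rewrite scaler_eq0 => /orP[/eqP h|/eqP//].
have := of_real_neq0 (s := s) _ (lt0r_neq0 (powR_gt0 (gamma n.+1) (alpha_gt0 n.+1))).
by rewrite h eqxx.
Qed.

Lemma NSIFT_error_coef n i : I i ->
  '[xdag - x n, v i] =
  of_real s (NSIFT_residual alpha gamma n (sg i)) * '[xdag, v i].
Proof.
move=> Ii; have [x0 rec] := x_NSIFT.
elim: n => [|n IH].
  by rewrite x0 subr0 /NSIFT_residual big_geq// of_real1 mul1r.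
have := congr1 (fun z => '[z, v i]) (rec n.+1 isT).
have shift_b : bounded_on_spectrum S (fun t => (t + alpha n.+1) `^ gamma n.+1).
  exact/bounded_pow_shift/gamma_ge0/ltW.
rewrite /pow_KstK_shift /pow_KstK pow_KstK_adjE inner_fun_KstK//.
rewrite linearDl/= linearBl/= !inner_fun_KstK//; last exact: bounded_pow.
rewrite inner_v_sum//; last first.
  exact/(square_summable_fun S (fun t => t `^ gamma n.+1))/bounded_pow.
rewrite NSIFT_residualS of_realM mulrAC -IH !linearBl/= /NSIFT_factor.
have s0 := sve_val_gt0 Ii.
rewrite powR_sqr ?(ltW s0)//.
set A := (_ + _) `^ _; set B := _ `^ _.
have A0 : of_real s A != 0.
  by rewrite of_real_neq0// lt0r_neq0// powR_gt0// ltr_wpDl ?sqr_ge0.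
rewrite of_realB of_real1 of_realM of_realV.
by move=> rec_n; rewrite -mulrBl; exact: relaxation_error rec_n.
Qed.

End NSIFT.

Theorem theorem34 (R : realType) (s : scalar_kind) (X Y : hilbertType R s)
  (K : {linear X -> Y}) (K_compact : compact_operator K) (S : sve K)
  (alpha gamma : nat -> R)
  (alpha_gt0 : forall n, 0 < alpha n) (gamma_ge : forall n, 1 / 2 <= gamma n)
  (y : Y) (y_attainable : range K y)
  (xdag : X) (xdagE : xdag = moore_penrose K y)
  (x : nat -> X) (x_NSIFT : is_NSIFT S alpha gamma y x)
  (x_cvg : x n @[n --> \oo] --> xdag)
  (nu : R) (nu_gt0 : 0 < nu) (xdag_source : source_space S nu xdag)
  (theta : nat -> R) (theta_gt0 : forall n, 0 < theta n)
  (theta_div : theta n @[n --> \oo] --> +oo)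
  (rate_cvg0 : forall sigma, (sve_spectrum S `\ 0) sigma ->
     theta n * sigma `^ nu * NSIFT_residual alpha gamma n sigma
       @[n --> \oo] --> 0)
  (c : R)
  (rate_bounded : forall n,
     (ereal_sup [set (theta n * sigma `^ nu *
                      NSIFT_residual alpha gamma n sigma)%:E
                | sigma in sve_spectrum S `\ 0%R] <= c%:E)%E) :
  (fun n => `|xdag - x n| : (scalars R s)^o) =o_\oo
  (fun n => of_real s (theta n)^-1 : (scalars R s)^o).
Proof.
have gamma_gt0 n : 0 < gamma n by rewrite (lt_le_trans _ (gamma_ge n))// divr_gt0.
have K_xdag : K xdag = y by rewrite xdagE (moore_penroseK S).
have [omega _ omegaE] := xdag_source.
have nu2_ge0 : 0 <= nu / 2 by rewrite divr_ge0// ltW.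
have xdag_coef i : sve_idx S i ->
    '[xdag, sve_v S i] = of_real s (sve_val S i `^ nu) * '[omega, sve_v S i].
  move=> Ii; rewrite -omegaE /pow_KstK inner_fun_KstK//; last exact: bounded_pow.
  by rewrite powR_sqr ?(ltW (sve_val_gt0 Ii))// [2 * _]mulrC divfK.
(* The source operator kills N(K), as 0 to the power nu/2 > 0 is 0. *)
have xdag_null : null_part S xdag = 0.
  rewrite -omegaE null_part_fun_KstK; last exact: bounded_pow.
  by rewrite powR0 ?of_real0 ?scale0r// gt_eqF// divr_gt0.
have spec i : sve_idx S i -> (sve_spectrum S `\ 0) (sve_val S i).
  move=> Ii; split; first by apply: subset_closure; exists i.
  by apply/eqP; rewrite gt_eqF// (sve_val_gt0 Ii).
pose g n i := of_real s (theta n * sve_val S i `^ nu *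
  NSIFT_residual alpha gamma n (sve_val S i)).
have g_le n i : sve_idx S i -> `|g n i| <= of_real s `|c|.
  move=> Ii; have s0 := ltW (sve_val_gt0 Ii).
  rewrite norm_of_real ler_of_real ger0_norm; last first.
    rewrite !mulr_ge0 ?powR_ge0 ?(ltW (theta_gt0 n))//.
    by apply: NSIFT_residual_ge0 => // k; exact: ltW.
  rewrite (le_trans _ (ler_norm c))// -lee_fin (le_trans _ (rate_bounded n))//.
  by apply: ereal_sup_ubound; exists (sve_val S i) => //; exact: spec.
have g_cvg i : sve_idx S i -> g n i @[n --> \oo] --> 0.
  by move=> Ii; rewrite -of_real0; apply: cvg_of_real; exact: rate_cvg0 (spec i Ii).
have scaled_error : of_real s (theta n) *: (xdag - x n) @[n --> \oo] --> 0.
  apply: (cvg_weighted0 (@sve_v_orthonormal _ _ _ _ _ S) _ g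
    (fun i => '[omega, sve_v S i]) (of_real s `|c|)) => //.
  - by apply: square_summable_coef; exact: sve_v_orthonormal.
  - by rewrite -of_real0 ler_of_real.
  - move=> n.
    have : null_part S (of_real s (theta n) *: (xdag - x n)) = 0.
      rewrite null_partZ null_partB xdag_null.
      by rewrite (null_part_NSIFT S alpha_gt0 gamma_gt0 K_xdag x_NSIFT) subr0 scaler0.
    move/null_part_eq0_cvg.
    have -> // : partial_sum (sve_idx S) (sve_v S)
        (fun i => '[of_real s (theta n) *: (xdag - x n), sve_v S i]) 0 =
      partial_sum (sve_idx S) (sve_v S) (fun i => g n i * '[omega, sve_v S i]) 0.
    apply/funext => m; apply: eq_partial_sum => i Ii.
    rewrite linearZl_LR/= (NSIFT_error_coef S alpha_gt0 gamma_gt0 K_xdag x_NSIFT)//.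
    by rewrite xdag_coef// /g !of_realM -!mulrA; congr (_ * _); rewrite mulrCA.
apply/eqoP => e e0.
move/cvgr0Pnorm_le: scaled_error => /(_ e e0); apply: filterS => n.
have theta0 : 0 < of_real s (theta n) by rewrite -of_real0 ltr_of_real.
rewrite normr_id normrZ of_realV normfV (gtr0_norm theta0) ler_pdivlMr//.
by rewrite mulrC.
Qed.
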